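(* Let $Q_\infty=(q_0,q_1,q_2,\dots)$ be an infinite stochastic vector with positive coordinates and fix a GLS-expansion with cylinder lengths given by $Q_\infty$. Let $(\xi_k)_{k\ge1}$ be independent identically distributed random variables with $P(\xi_k=i)=p_i\ge 0$, $\sum_{i\ge 0}p_i=1$, let $\xi=\Delta^{\mathit{GLS}}_{\xi_1\xi_2\dots\xi_k\dots}$, and let $S_\xi$ be the spectrum of the distribution of $\xi$. Let $V:=\{i:p_i>0\}=\{i_1,i_2,\dots\}$. Suppose the set $\Delta^{\mathit{GLS}}_\infty$ is at most countable. Then: (1) if the equation $\sum_{i\in V}q_i^x=1$ has one root $\alpha_0$ on $[0,1]$, then $\dim_H S_\xi=\alpha_0$; (2) if the equation $\sum_{i\in V}q_i^x=1$ has no roots on $[0,1]$, then $\dim_H S_\xi=\lim_{k\to\infty}\alpha_k$, where $\alpha_k$ is the root of the equation $\sum_{i\in V_k}q_i^x=1$ with $V_k=\{i_1,i_2,\dots,i_k\}\subset V$.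
   Context: GLS-expansion: Let $Q_\infty=(q_0,q_1,\dots)$ be a stochastic vector with positive coordinates ($q_i>0$, $\sum_{i\ge 0} q_i=1$). Choose closed intervals $\Delta_i=[a_i,b_i]\subset[0,1]$, $i\in\mathbb{N}_0=\{0,1,2,\dots\}$, with pairwise disjoint interiors and $|\Delta_i|=q_i$ (cylinders of rank 1). Let $f_i:[0,1]\to\Delta_i$ be the increasing affine bijection. The cylinders of rank $n$ are $\Delta_{i_1i_2\dots i_n}=f_{i_1}\circ\dots\circ f_{i_n}([0,1])$, so the placement of $\Delta_{i_1\dots i_n}$ inside $\Delta_{i_1\dots i_{n-1}}$ is the same as that of $\Delta_{i_n}$ inside $[0,1]$ and $|\Delta_{i_1\dots i_n}|=q_{i_1}\cdots q_{i_n}$. For any sequence $(i_k)$ in $\mathbb{N}_0$, $\bigcap_k \Delta_{i_1\dots i_k}$ is a single point, denoted $\Delta^{\mathit{GLS}}_{i_1i_2\dots}$. $\Delta^{\mathit{GLS}}_\infty$ denotes the set of points of $[0,1]$ not belonging to any cylinder of rank 1, i.e. $[0,1]\setminus\bigcup_i\Delta_i$. The spectrum $S_\xi$ of the distribution of $\xi$ is its support: the minimal closed set $S$ with $P(\xi\in S)=1$. *)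

(* Defs.v *)
From HB Require Import structures.
From mathcomp Require Import all_boot all_order all_algebra.
From mathcomp Require Import all_classical all_reals all_analysis.
Set Implicit Arguments. Unset Strict Implicit. Unset Printing Implicit Defensive.
Import Order.TTheory GRing.Theory Num.Theory.
Import numFieldNormedType.Exports.
Local Open Scope classical_set_scope.
Local Open Scope ring_scope.

Section GLS.
Variable R : realType.

(** A GLS-expansion: cylinders of rank 1 are Delta_i = [a i, a i + q i]. *)
Definition gls_system (q a : nat -> R) : Prop :=
  (forall i, 0 < q i) /\
  (\sum_(i <oo) (q i)%:E = 1)%E /\
  (forall i, 0 <= a i /\ a i + q i <= 1) /\
  (forall i j, i <> j -> a i + q i <= a j \/ a j + q j <= a i).

Definition gls_f (q a : nat -> R) (i : nat) (x : R) : R := a i + q i * x.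

Fixpoint gls_comp (q a : nat -> R) (s : nat -> nat) (k : nat) (x : R) : R :=
  match k with
  | 0 => x
  | k'.+1 => gls_f q a (s 0%N) (gls_comp q a (fun n => s n.+1) k' x)
  end.

Definition gls_cylinder (q a : nat -> R) (s : nat -> nat) (k : nat) : set R :=
  gls_comp q a s k @` [set` `[0, 1]].

(** Delta^GLS_{s0 s1 ...}: the (unique) point of the intersection of the cylinders *)
Definition gls_point (q a : nat -> R) (s : nat -> nat) : R :=
  xget 0 (\bigcap_(k in setT) gls_cylinder q a s k).

Definition gls_infty (q a : nat -> R) : set R :=
  [set` `[0, 1]] `\` \bigcup_(i in setT) [set` `[a i, a i + q i]].

Definition diam (U : set R) : \bar R :=
  ereal_sup [set r | exists x y, U x /\ U y /\ r = (`|x - y|)%:E].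

Definition hterm (s : R) (U : set R) : \bar R :=
  if pselect (U = set0) then 0%E else ((fine (diam U)) `^ s)%:E.

Definition hausdorff_content (s delta : R) (E : set R) : \bar R :=
  ereal_inf [set (\sum_(j <oo) hterm s (U j))%E | U in
     [set U : nat -> set R | E `<=` \bigcup_(j in setT) U j /\
                             forall j, (diam (U j) <= delta%:E)%E]].

Definition hausdorff_measure (s : R) (E : set R) : \bar R :=
  ereal_sup [set hausdorff_content s delta E | delta in [set d : R | 0 < d]].

Definition hausdorff_dim (E : set R) : \bar R :=
  ereal_inf [set s%:E | s in [set s : R | 0 <= s /\ hausdorff_measure s E = 0%E]].

End GLS.

Section Prob.
Context {R : realType} {d : measure_display} {T : measurableType d}.

Definition indep_nat_seq (P : probability T R) (xi : nat -> T -> nat) : Prop :=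
  (forall k i, measurable [set t | xi k t = i]) /\
  forall (s : seq nat) (v : nat -> nat), uniq s ->
    P [set t | forall k, k \in s -> xi k t = v k] =
    (\prod_(k <- s) P [set t | xi k t = v k])%E.

Definition ident_distr (P : probability T R) (xi : nat -> T -> nat) (p : nat -> R) : Prop :=
  forall k i, P [set t | xi k t = i] = (p i)%:E.

Definition spectrum (P : probability T R) (X : T -> R) : set R :=
  \bigcap_(S in [set S : set R | closed S /\ P (X @^-1` S) = 1%E]) S.

End Prob.

(* Main.v *)
(** The spectrum of xi is the closure K of the set of points all of whose digits lie in V = {i | p i > 0}, and it satisfies f_i(K) <= K for i in V.

Upper bound: a limit of points of K that lies in the interior of Delta_i only sees points with first digit i, hence K is covered by the sets f_i(K), i in V, up to the countable set formed by Delta_infty and the endpoints of the cylinders of rank 1.  Transporting a delta-cover of K by all the f_i multiplies its cost by F(s), the sum of q_i^s over V, so the delta-content of K is at most F(s) times itself and vanishes when F(s) < 1.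

Lower bound: if a finite part of V has a sum of q_i^s greater than 1, a large iterate of this finite system, composed with one more map sending [0, 1] into ]0, 1[, is a strongly separated system with a sum of ratios to the power s at least 2.  Tiling [0, 1[ with lengths proportional to these powers and matching digits gives a map phi from [0, 1[ to K with |y - z| <= C |phi y - phi z|^s, so that by subadditivity of the Lebesgue measure any cover of K costs at least 1 / (2 C). *)
Require Import Defs.
From HB Require Import structures.
From mathcomp Require Import all_boot all_order all_algebra.
From mathcomp Require Import all_classical all_reals all_analysis.
From mathcomp Require Import ring lra.
Set Implicit Arguments. Unset Strict Implicit. Unset Printing Implicit Defensive.
Import Order.TTheory GRing.Theory Num.Theory.
Import numFieldNormedType.Exports.
Local Open Scope classical_set_scope.
Local Open Scope ring_scope.

(** * Hausdorff contents and self-affine covers *)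

Section Hausdorff.
Variable R : realType.
Implicit Types (U E K : set R) (s d x y : R).

Lemma diam_ge U x y : U x -> U y -> (`|x - y|%:E <= diam U)%E.
Proof. by move=> Ux Uy; apply: ereal_sup_ubound; exists x, y. Qed.

Lemma diam_le U d :
  (forall x y, U x -> U y -> `|x - y| <= d) -> (diam U <= d%:E)%E.
Proof.
move=> h; apply: ge_ereal_sup => _ [x [y [Ux [Uy ->]]]].
by rewrite lee_fin h.
Qed.

(** The bound by [d] matters because [fine] sends an infinite diameter to 0, which would break the
    inequality. *)
Lemma dist_le_fine_diam U d x y :
  (diam U <= d%:E)%E -> U x -> U y -> `|x - y| <= fine (diam U).
Proof.
move=> Ud Ux Uy; rewrite -lee_fin fineK ?diam_ge//.
rewrite fin_numE -ltNye -ltey (le_lt_trans Ud) ?ltry// andbT.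
by rewrite (lt_le_trans _ (diam_ge Ux Uy))// ltNyr.
Qed.

Lemma fine_diam_le U d (U0 : U !=set0) :
  (forall x y, U x -> U y -> `|x - y| <= d) -> 0 <= fine (diam U) <= d.
Proof.
move=> h; have [x Ux] := U0; have /= Ud := diam_le h.
have := dist_le_fine_diam Ud Ux Ux; rewrite subrr normr0 => ->/=.
rewrite -lee_fin fineK//.
rewrite fin_numE -ltNye -ltey (le_lt_trans Ud) ?ltry// andbT.
by rewrite (lt_le_trans _ (diam_ge Ux Ux))// ltNyr.
Qed.

Lemma hterm_ge0 s U : (0 <= hterm s U)%E.
Proof. by rewrite /hterm; case: pselect => //= _; rewrite lee_fin powR_ge0. Qed.

Lemma hterm_set0 s : hterm s (set0 : set R) = 0%E.
Proof. by rewrite /hterm; case: pselect. Qed.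

Lemma hterm_neq0 s U : U !=set0 -> hterm s U = (fine (diam U) `^ s)%:E.
Proof. by move=> /set0P/eqP U0; rewrite /hterm; case: pselect. Qed.

Lemma hterm_lty s U : (hterm s U < +oo)%E.
Proof. by rewrite /hterm; case: pselect => /= h; rewrite ltry. Qed.

(** This makes a countable set free in a cover. The case [s = 0] is excluded because 0 to the power
    0 is 1. *)
Lemma hterm_subsingleton s U :
  s != 0 -> (forall x y, U x -> U y -> x = y) -> hterm s U = 0%E.
Proof.
move=> s0 U1; have [->|/set0P U0] := eqVneq U set0; first exact: hterm_set0.
rewrite hterm_neq0//.
have /le_anti <- : 0 <= fine (diam U) <= 0; last by rewrite powR0.
by apply: fine_diam_le => // x y Ux Uy; rewrite (U1 _ _ Ux Uy) subrr normr0.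
Qed.

Lemma diam_affine_le U (b q d : R) : 0 <= q ->
  (diam U <= d%:E)%E -> (diam ((fun x => b + q * x)%R @` U) <= (q * d)%:E)%E.
Proof.
move=> q0 Ud; apply: diam_le => _ _ [x Ux <-] [y Uy <-].
rewrite (_ : _ - _ = q * (x - y)); last by ring.
rewrite normrM (ger0_norm q0) ler_wpM2l//.
by rewrite -lee_fin (le_trans (diam_ge Ux Uy)).
Qed.

Lemma hterm_affine_le s U (b q d : R) : 0 <= s -> 0 <= q -> (diam U <= d%:E)%E ->
  (hterm s ((fun x => b + q * x)%R @` U) <= (q `^ s)%:E * hterm s U)%E.
Proof.
move=> s0 q0 Ud; have [->|/set0P U0] := eqVneq U set0.
  by rewrite image_set0 hterm_set0 mule0.
have fU0 : (fun x => b + q * x) @` U !=set0.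
  by case: U0 => x Ux; exists (b + q * x), x.
rewrite !hterm_neq0// -EFinM lee_fin.
have h x y : U x -> U y -> `|x - y| <= fine (diam U).
  by move=> Ux Uy; exact: dist_le_fine_diam Ud _ _.
have /andP[D0 _] := fine_diam_le U0 h.
rewrite -powRM//.
have /andP[D'0 D'1] : 0 <= fine (diam ((fun x => b + q * x) @` U)) <= q * fine (diam U).
  apply: fine_diam_le => // _ _ [x Ux <-] [y Uy <-].
  rewrite (_ : _ - _ = q * (x - y)); last by ring.
  by rewrite normrM (ger0_norm q0) ler_wpM2l// h.
by apply: ge0_ler_powR => //; rewrite nnegrE// mulr_ge0.
Qed.

Lemma hausdorff_content_ge0 s d K : (0 <= hausdorff_content s d K)%E.
Proof.
apply: le_ereal_inf_tmp => _ [U _ <-].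
by apply: nneseries_ge0 => i _ _; exact: hterm_ge0.
Qed.

Lemma hausdorff_content_le_cost s d K (U : nat -> set R) :
  K `<=` \bigcup_(j in setT) U j -> (forall j, (diam (U j) <= d%:E)%E) ->
  (hausdorff_content s d K <= \sum_(j <oo) hterm s (U j))%E.
Proof. by move=> KU Ud; apply: ereal_inf_lbound; exists U. Qed.

(** A doubly indexed cover becomes a sequence through a bijection between [nat] and [nat * nat]; the
    terms are nonnegative, so the order of summation is irrelevant. *)
Lemma hausdorff_content_le_cost2 s d K (U : nat -> nat -> set R) :
  (forall x, K x -> exists i j, U i j x) ->
  (forall i j, (diam (U i j) <= d%:E)%E) ->
  (hausdorff_content s d K <= \sum_(i <oo) \sum_(j <oo) hterm s (U i j))%E.
Proof.
move=> KU Ud; have /card_esym/ppcard_eqP[f] := card_nat2.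
have -> : (\sum_(i <oo) \sum_(j <oo) hterm s (U i j) =
    \sum_(n <oo) hterm s (U (f n).1 (f n).2))%E.
  rewrite [RHS]nneseries_esumT; last by move=> n; exact: hterm_ge0.
  rewrite -(@reindex_esum _ _ _ _ [set: nat * nat] f
    (fun ij => hterm s (U ij.1 ij.2)))//.
  rewrite (_ : [set: nat * nat] = setT `*`` (fun=> setT)); last first.
    by apply/seteqP; split.
  rewrite -(@esum_esum _ _ _ _ _ (fun i j => hterm s (U i j))); last first.
    by move=> *; exact: hterm_ge0.
  rewrite nneseries_esumT; last first.
    by move=> i; apply: nneseries_ge0 => *; exact: hterm_ge0.
  by apply: eq_esum => i _; rewrite nneseries_esumT// => *; exact: hterm_ge0.
apply: hausdorff_content_le_cost => [x /KU[i [j Uijx]]|n]; last exact: Ud.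
by exists (f^-1%FUN (i, j)) => //; rewrite invK ?inE.
Qed.

(** Finiteness is what later lets a content bounded by [F < 1] times itself be forced to 0. *)
Lemma hausdorff_content_lty s d K : 0 < d -> K `<=` [set` `[0, 1]] ->
  (hausdorff_content s d K < +oo)%E.
Proof.
move=> d0 K01.
have [n nd] : exists n : nat, d^-1 < n.+1%:R.
  by exists (Num.trunc d^-1); rewrite truncnS_gt// invr_ge0 ltW.
(* Pieces of length at most 1/(n+1). The value [j = n.+1] is reached only at [x = 1], hence [n.+2]
   possibly nonempty pieces. *)
pose U (j : nat) : set R := [set x | 0 <= x <= 1 /\ Num.trunc (x * n.+1%:R) = j].
have Un j : (n.+1 < j)%N -> U j = set0.
  move=> nj; apply/seteqP; split => // x [/andP[x0 x1]] h.
  suff : (j <= n.+1)%N by rewrite leqNgt nj.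
  rewrite -h -(@ler_nat R); apply: le_trans (_ : x * n.+1%:R <= _).
    by rewrite truncn_le mulr_ge0.
  by rewrite ler_piMl.
apply: le_lt_trans (@hausdorff_content_le_cost s d K U _ _) _.
- move=> x /K01; rewrite /= in_itv/= => x01.
  by exists (Num.trunc (x * n.+1%:R)).
- move=> j; apply: diam_le => x y [/andP[x0 x1] hx] [/andP[y0 y1] hy].
  have := @truncn_itv _ (x * n.+1%:R); rewrite mulr_ge0// => /(_ isT).
  have := @truncn_itv _ (y * n.+1%:R); rewrite mulr_ge0// => /(_ isT).
  rewrite hx hy -addn1 natrD => /andP[y2 y3] /andP[x2 x3].
  have : `|x - y| * n.+1%:R <= 1.
    by rewrite -[n.+1%:R]ger0_norm// -normrM mulrBl ler_norml; lra.
  rewrite -ler_pdivlMr// div1r => /le_trans; apply.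
  by rewrite -[leRHS]invrK lef_pV2 ?posrE ?invr_gt0// ltW.
- rewrite (@nneseries_split _ _ 0 n.+2); last by move=> *; exact: hterm_ge0.
  rewrite [X in (_ + X)%E]eseries0 ?adde0; last first.
    by move=> i /= ni _; rewrite Un ?hterm_set0// -(add0n n.+2).
  by apply: lte_sum_pinfty => i _; exact: hterm_lty.
Qed.

Lemma hausdorff_measure_eq0 s K :
  (forall d, 0 < d -> hausdorff_content s d K = 0%E) ->
  hausdorff_measure s K = 0%E.
Proof.
move=> h; apply/le_anti/andP; split.
  by apply: ge_ereal_sup => _ [d /= d0 <-]; rewrite h.
by rewrite -(h 1)//; apply: ereal_sup_ubound; exists 1 => //=.
Qed.

Lemma hausdorff_measure_self_affine (V : pred nat) (a q : nat -> R) N K s :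
  0 < s -> (forall i, 0 <= q i <= 1) -> K `<=` [set` `[0, 1]] ->
  countable N ->
  K `<=` N `|` \bigcup_(i in V) (fun x => a i + q i * x) @` K ->
  (\sum_(i <oo | V i) (q i `^ s)%:E < 1)%E ->
  hausdorff_measure s K = 0%E.
Proof.
move=> s0 q01 K01 /countable_injP[g ginj] KNf F1.
apply: hausdorff_measure_eq0 => d d0.
have F0 : (0 <= \sum_(i <oo | V i) (q i `^ s)%:E)%E.
  by apply: nneseries_ge0 => i _ _; rewrite lee_fin powR_ge0.
have Ffin : (\sum_(i <oo | V i) (q i `^ s)%:E)%E \is a fin_num.
  by rewrite ge0_fin_numE// (lt_trans F1)// ltry.
set F := fine (\sum_(i <oo | V i) (q i `^ s)%:E)%E.
have FE : (\sum_(i <oo | V i) (q i `^ s)%:E)%E = F%:E by rewrite fineK.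
have {}F0 : 0 <= F by rewrite fine_ge0.
have {}F1 : F < 1 by rewrite -lte_fin -FE.
have cfin : hausdorff_content s d K \is a fin_num.
  by rewrite ge0_fin_numE ?hausdorff_content_ge0// hausdorff_content_lty.
set c := fine (hausdorff_content s d K).
have cE : hausdorff_content s d K = c%:E by rewrite fineK.
have c0 : 0 <= c by rewrite fine_ge0// hausdorff_content_ge0.
have key (M : R) (U : nat -> set R) : K `<=` \bigcup_(j in setT) U j ->
    (forall j, (diam (U j) <= d%:E)%E) ->
    (\sum_(j <oo) hterm s (U j))%E = M%:E -> c <= M * F.
  move=> KU Ud UM.
  have M0 : 0 <= M.
    by rewrite -lee_fin -UM; apply: nneseries_ge0 => *; exact: hterm_ge0.
  (* Row 0 cuts the countable set [N] into singletons through its injection [g]; row [k.+1] is the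
     image of the given cover under the [k]-th map. *)
  pose W i j := if i is k.+1 then
      (if V k then (fun x => a k + q k * x) @` U j else set0)
    else N `&` [set x | g x = j].
  have W0 i j : (0 <= hterm s (W i j))%E by exact: hterm_ge0.
  have Wx x : K x -> exists i j, W i j x.
    move=> /KNf[Nx|[k Vk [y Ky <-]]]; first by exists 0%N, (g x).
    have [j _ Uj] := KU _ Ky.
    by exists k.+1, j; rewrite /= ifT//; exists y.
  have W1 j x y : W 0%N j x -> W 0%N j y -> x = y.
    by move=> /= [Nx gx] [Ny gy]; apply: ginj; rewrite ?inE ?gx.
  have Wd i j : (diam (W i j) <= d%:E)%E.
    case: i => [|k].
      by apply: diam_le => x y /W1 h /h ->; rewrite subrr normr0 ltW.
    rewrite /W; case: ifP => _; last by apply: diam_le.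
    have [qk0 qk1] := andP (q01 k).
    apply: le_trans (diam_affine_le (a k) qk0 (Ud j)) _.
    by rewrite lee_fin ler_piMl// ltW.
  rewrite -lee_fin -cE (le_trans (hausdorff_content_le_cost2 s Wx Wd))//.
  rewrite (@nneseries_split _ _ 0 1); last first.
    by move=> *; apply: nneseries_ge0 => *; exact: W0.
  rewrite big_nat1 [X in (X + _)%E]eseries0 ?add0e; last first.
    move=> j _ _; apply: hterm_subsingleton; first by rewrite gt_eqF.
    exact: W1.
  rewrite EFinM -FE -nneseriesZl; last by move=> *; rewrite lee_fin powR_ge0.
  rewrite -nneseries_addn; last first.
    by move=> *; apply: nneseries_ge0 => *; exact: W0.
  rewrite [leRHS]eseries_mkcond.
  apply: lee_nneseries => k _ *; first by apply: nneseries_ge0 => *; exact: W0.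
  rewrite [(k + 1)%N]addn1 /W; case: ifP => Vk; last first.
    by rewrite eseries0 => // j _ _; exact: hterm_set0.
  rewrite muleC -UM -nneseriesZl; last by move=> *; exact: hterm_ge0.
  apply: lee_nneseries => j _ *; first exact: hterm_ge0.
  by apply: hterm_affine_le (Ud j); [exact: ltW|case/andP: (q01 k)].
rewrite cE; congr (_%:E); apply/eqP; rewrite eq_le c0 andbT leNgt.
apply/negP => cgt0.
(* With this slack the chosen cover costs less than c (2 - F), so [key] gives c <= c (2 - F) F, that
   is c (1 - F)^2 <= 0, against [0 < c]. *)
have e0 : 0 < c * (1 - F) by rewrite mulr_gt0// subr_gt0.
have [_ [U [KU Ud] <-]] := lb_ereal_inf_adherent e0 cfin.
rewrite [ereal_inf _]cE => Ult.
have Ufin : (\sum_(j <oo) hterm s (U j))%E \is a fin_num.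
  rewrite ge0_fin_numE; first by rewrite (lt_trans Ult)// -EFinD ltry.
  by apply: nneseries_ge0 => *; exact: hterm_ge0.
have := key _ _ KU Ud (esym (fineK Ufin)).
move: Ult; rewrite -{1}(fineK Ufin) -EFinD lte_fin.
set M := fine _ => Mlt cM.
by have : M * F <= (c + c * (1 - F)) * F; [rewrite ler_wpM2r// ltW|nra].
Qed.

End Hausdorff.
(** * Points with a given sequence of digits *)

Section Point.
Variable R : realType.

Lemma nested_intervals (u v : nat -> R) :
  (forall n, u n <= u n.+1) -> (forall n, v n.+1 <= v n) ->
  (forall n, u n <= v n) -> exists l, forall n, u n <= l <= v n.
Proof.
move=> unD vnI uv.
have uD : nondecreasing_seq u by apply/nondecreasing_seqP.
have vI : nonincreasing_seq v by apply/nonincreasing_seqP.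
have uvm m n : u m <= v n.
  apply: le_trans (uD _ _ (leq_maxl m n)) _.
  exact: le_trans (uv _) (vI _ _ (leq_maxr m n)).
exists (sup (range u)) => n; apply/andP; split.
  apply: ub_le_sup; last by exists n.
  by exists (v 0%N) => _ [m _ <-].
by apply: ge_sup; [exists (u 0%N), 0%N | move=> _ [m _ <-]].
Qed.

Lemma geometric_cvg (u : nat -> R) (r l : R) : 0 <= r < 1 ->
  (forall n, `|u n - l| <= r ^+ n) -> u @ \oo --> l.
Proof.
move=> /andP[r0 r1] ul; apply/cvgrPdist_le => e e0.
have : (GRing.exp r) n @[n --> \oo] --> (0 : R).
  by apply: cvg_expr; rewrite ger0_norm.
move=> /cvgrPdist_le /(_ _ e0); apply: filterS => n.
by rewrite sub0r normrN ger0_norm ?exprn_ge0// distrC; exact: le_trans.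
Qed.

Lemma geometric_le (r x y : R) : 0 <= r < 1 ->
  (forall n, x <= y + r ^+ n) -> x <= y.
Proof.
move=> r01 h; rewrite leNgt; apply/negP => yx.
have : (fun n => y + r ^+ n) @ \oo --> y.
  apply: (geometric_cvg r01) => n.
  by rewrite addrAC subrr add0r ger0_norm// exprn_ge0//; case/andP: r01.
move=> /cvgrPdist_lt/(_ (x - y)); rewrite subr_gt0 => /(_ yx)[n _ /(_ n)].
move=> /(_ (leqnn _)); have := h n.
by rewrite /= opprD addrA subrr sub0r normrN ger0_norm ?exprn_ge0//;
  [lra|case/andP: r01].
Qed.

Variables (q a : nat -> R) (r : R).
Hypothesis qr : forall i, 0 < q i <= r.
Hypothesis r1 : r < 1.
Hypothesis a01 : forall i, 0 <= a i /\ a i + q i <= 1.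

Local Definition clen (s : nat -> nat) k : R := \prod_(j < k) q (s j).

Let r01 : 0 <= r < 1.
Proof.
by rewrite r1 andbT; have /andP[q0 /(lt_le_trans q0)/ltW] := qr 0.
Qed.

Lemma clenS s k : clen s k.+1 = q (s 0%N) * clen (fun n => s n.+1) k.
Proof. by rewrite /clen big_ord_recl. Qed.

Lemma clen_gt0 s k : 0 < clen s k.
Proof. by rewrite prodr_gt0// => j _; case/andP: (qr (s j)). Qed.

Lemma clen_le s k : clen s k <= r ^+ k.
Proof.
rewrite -[leRHS](_ : \prod_(j < k) r = _); last by rewrite prodr_const card_ord.
by apply: ler_prod => j _; have /andP[/ltW-> ->] := qr (s j).
Qed.

Lemma gls_comp_affine s k x : gls_comp q a s k x = gls_comp q a s k 0 + clen s k * x.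
Proof.
elim: k s x => [|k IH] s x /=; first by rewrite /clen big_ord0; ring.
by rewrite /gls_f IH clenS; ring.
Qed.

(** The recursion peels off the outermost map; peeling off the innermost one shows that the
    cylinders are nested. *)
Lemma gls_comp_S s k x : gls_comp q a s k.+1 x = gls_comp q a s k (gls_f q a (s k) x).
Proof.
elim: k s x => [|k IH] s x //.
exact: (congr1 (gls_f q a (s 0%N)) (IH (fun n => s n.+1) x)).
Qed.

Lemma gls_f01 i x : 0 <= x <= 1 -> 0 <= gls_f q a i x <= 1.
Proof.
move=> /andP[x0 x1]; rewrite /gls_f.
by have [a0 aq] := a01 i; have /andP[q0 _] := qr i; nra.
Qed.

Lemma gls_cylinderP s k x : gls_cylinder q a s k x <->
  gls_comp q a s k 0 <= x <= gls_comp q a s k 0 + clen s k.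
Proof.
have l0 := clen_gt0 s k; split.
  move=> [y]; rewrite /= in_itv/= => /andP[y0 y1] <-.
  by rewrite (gls_comp_affine s k y) lerDl lerD2l mulr_ge0 ?(ltW l0)//= ler_piMr// ltW.
move=> /andP[h0 h1]; exists ((x - gls_comp q a s k 0) / clen s k).
  rewrite /= in_itv/= divr_ge0 ?subr_ge0 ?(ltW l0)//=.
  by rewrite ler_pdivrMr// mul1r lerBlDl.
by rewrite gls_comp_affine mulrC divfK ?gt_eqF// addrC subrK.
Qed.

(** Nested closed intervals have a common point, so the default value 0 of [xget] is never an
    accidental choice. *)
Lemma gls_cylinder_point s k : gls_cylinder q a s k (gls_point q a s).
Proof.
suff : (\bigcap_(k in setT) gls_cylinder q a s k) (gls_point q a s) by exact.
rewrite /gls_point; case: xgetP => // h.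
have [n|n|n|l hl] := @nested_intervals (fun n => gls_comp q a s n 0)
    (fun n => gls_comp q a s n 0 + clen s n).
- rewrite gls_comp_S [leRHS]gls_comp_affine lerDl mulr_ge0//.
    exact/ltW/clen_gt0.
  by rewrite /gls_f mulr0 addr0; case: (a01 (s n)).
- rewrite -[clen s n.+1]mulr1 -[clen s n]mulr1 -!gls_comp_affine gls_comp_S.
  rewrite gls_comp_affine (gls_comp_affine s n 1) lerD2l ler_wpM2l//.
    exact/ltW/clen_gt0.
  by rewrite /gls_f mulr1; case: (a01 (s n)).
- by rewrite lerDl; exact/ltW/clen_gt0.
- by case: (h l) => n _; apply/gls_cylinderP.
Qed.

Lemma gls_cylinder_dist s k x y :
  gls_cylinder q a s k x -> gls_cylinder q a s k y -> `|x - y| <= r ^+ k.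
Proof.
move=> /gls_cylinderP/andP[x1 x2] /gls_cylinderP/andP[y1 y2].
by have := clen_le s k; rewrite ler_distl => h; lra.
Qed.

Lemma gls_point_unique s x :
  (forall k, gls_cylinder q a s k x) -> x = gls_point q a s.
Proof.
move=> h; apply/le_anti/andP; split; apply: (geometric_le r01) => k.
all: by have := gls_cylinder_dist (h k) (@gls_cylinder_point s k);
  rewrite ler_distl => /andP[]; lra.
Qed.

Lemma gls_point01 s : 0 <= gls_point q a s <= 1.
Proof.
by have [z] := @gls_cylinder_point s 0; rewrite /= in_itv/= => ? <-.
Qed.

Lemma gls_pointS s :
  gls_point q a s = gls_f q a (s 0%N) (gls_point q a (fun n => s n.+1)).
Proof.
apply/esym/gls_point_unique => -[|k].
  exists (gls_f q a (s 0%N)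
    (gls_point q a (fun n => s n.+1))) => //.
  by rewrite /= in_itv/=; apply: gls_f01; exact: gls_point01.
have [y y01 <-] := @gls_cylinder_point (fun n => s n.+1) k.
by exists y.
Qed.

(** Both points lie in the same cylinder of rank [k], of length at most [r ^+ k]. This gives
    membership in closed stable sets and measurability of the coded point. *)
Lemma gls_comp_cvg s x : 0 <= x <= 1 ->
  gls_comp q a s k x @[k --> \oo] --> gls_point q a s.
Proof.
move=> x01; apply: (geometric_cvg r01) => k.
apply: (@gls_cylinder_dist s) (gls_cylinder_point _ _).
by exists x => //; rewrite /= in_itv.
Qed.

End Point.

(** * Lower bound for affine systems *)

Section Lower.
Variable R : realType.

(** The tiles are laid end to end in the order of the enumeration: [B i] is the total length before
    [i]. *)
Lemma tiling (I : finType) (sg : I -> R) : \sum_i sg i = 1 ->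
  exists B : I -> R, forall y, 0 <= y < 1 -> exists i, B i <= y < B i + sg i.
Proof.
move=> sg1; pose e := index_enum I.
pose B i := \sum_(j <- take (index i e) e) sg j.
exists B => y /andP[y0]; rewrite -sg1 -[X in \sum_(i <- X) _]take_size -/e.
have := leqnn (size e); move: {1 3}(size e) => m.
elim: m => [|m IH] me; first by rewrite take0 big_nil ltNge y0.
have [i0 _] : exists i0 : I, true by case: (e) me => // i0; exists i0.
rewrite (take_nth i0)// -cats1 big_cat big_seq1/=.
have [/(IH (ltnW me))//|yB] := ltP y (\sum_(j <- take m e) sg j) => ylt.
by exists (nth i0 e m); rewrite /B index_uniq ?index_enum_uniq// yB.
Qed.

(* [phi y] is the point of [K] whose digits are those of [y] in the tiling of [0, 1[ with lengths [sg i = rho i ^ s / Z]; [Hphi] is its inverse Holder inequality. *)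
Lemma hausdorff_measure_separated (I : finType) (A rho : I -> R) (K : set R)
    (s r g : R) :
  closed K -> K !=set0 -> K `<=` [set` `[0, 1]] ->
  (forall i, 0 < rho i <= r) -> r < 1 -> 0 <= s ->
  (forall i, 0 <= A i /\ A i + rho i <= 1) ->
  (forall i x, K x -> K (A i + rho i * x)) -> 0 < g ->
  (forall i j x y, i != j -> 0 <= x <= 1 -> 0 <= y <= 1 ->
    g <= `|(A i + rho i * x) - (A j + rho j * y)|) ->
  2 <= \sum_i rho i `^ s -> hausdorff_measure s K <> 0%E.
Proof.
move=> clK [x0 Kx0] K01 rhor r1 s0 A01 KA g0 sep.
set Z := \sum_i _ => Z2.
have Z0 : 0 < Z by rewrite (lt_le_trans _ Z2).
pose sg i := rho i `^ s / Z.
have sg0 i : 0 < sg i.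
  by rewrite divr_gt0// powR_gt0//; case/andP: (rhor i).
have sgrho i : sg i <= rho i `^ s.
  by rewrite ler_pdivrMr// ler_peMr ?powR_ge0// (le_trans _ Z2)// ler1n.
(* The lower bound 2 on [Z] serves here: each step of the coding at least halves lengths in [0, 1[,
   so the error term in [Hphi] vanishes. *)
have sg2 i : sg i <= 2^-1.
  rewrite ler_pdivrMr// (@le_trans _ _ 1)//; last by lra.
  have /andP[rho0 rho1] := rhor i.
  have p1 : (1 : R) `^ s = 1 by rewrite powR1.
  rewrite -[leRHS]p1; apply: ge0_ler_powR; rewrite ?nnegrE//; first exact: ltW.
  by rewrite (le_trans rho1)// ltW.
have sg1 : \sum_i sg i = 1 by rewrite -mulr_suml divff// gt_eqF.
have [B BP] := tiling sg1.
have [i0 _] : exists i0 : I, true.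
  by have [i1 _] := BP 0 (introT andP (conj (lexx 0) ltr01)); exists i1.
(* [k] reads the first digit in the tiling and [T] is the associated expanding shift; the default
   [i0] does not occur on [0, 1[. *)
pose k y := xget i0 [set i | B i <= y < B i + sg i].
have kP y : 0 <= y < 1 -> B (k y) <= y < B (k y) + sg (k y).
  by move=> /BP[i hi]; rewrite /k; case: xgetP => [j -> //|/(_ i)].
pose T y := (y - B (k y)) / sg (k y).
have T01 y : 0 <= y < 1 -> 0 <= T y < 1.
  move=> /kP/andP[h1 h2]; rewrite /T divr_ge0 ?subr_ge0 ?(ltW (sg0 _))//=.
  by rewrite ltr_pdivrMr// mul1r ltrBlDl.
have TE y : y = B (k y) + sg (k y) * T y.
  by rewrite /T mulrC divfK ?gt_eqF// addrC subrK.
pose e := index_enum I.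
(* The finite system is re-indexed by [nat], repeating the map [i0] past the end, so that
   [gls_point] applies to it. *)
pose q' n := rho (nth i0 e n); pose a' n := A (nth i0 e n).
have q'r n : 0 < q' n <= r by exact: rhor.
have a'01 n : 0 <= a' n /\ a' n + q' n <= 1 by exact: A01.
pose dg y n := index (k (iter n T y)) e.
have nthdg y n : nth i0 e (dg y n) = k (iter n T y).
  by rewrite nth_index// mem_index_enum.
pose phi y := gls_point q' a' (dg y).
have phi01 y : 0 <= phi y <= 1 by exact: gls_point01 q'r a'01 _.
have phiE y : phi y = A (k y) + rho (k y) * phi (T y).
  rewrite /phi (gls_pointS q'r r1 a'01) /gls_f /q' /a' nthdg /=.
  congr (_ + _ * gls_point _ _ _).
  by apply/funext => n; rewrite /dg -iterSr.
have Kphi y : K (phi y).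
  apply: (@closed_cvg _ _ \oo _ (fun n => gls_comp q' a' (dg y) n x0) _ clK).
    apply: nearW => n; elim: n (dg y) => [|n IH] t //=.
    exact: KA.
  apply: (gls_comp_cvg q'r r1 a'01).
  by have := K01 _ Kx0; rewrite /= in_itv.
clearbody phi T sg.
pose C := (g `^ s)^-1.
have C0 : 0 < C by rewrite invr_gt0 powR_gt0.
(* Equal first digits: the left side scales by [sg], at most the factor gained on the right, and the
   error is halved. Distinct first digits: the gap [g] makes the first term on the right at least 1,
   by the choice of [C]. *)
have Hphi n : forall y z, 0 <= y < 1 -> 0 <= z < 1 ->
    `|y - z| <= C * `|phi y - phi z| `^ s + 2^-1 ^+ n.
  elim: n => [|n IH] y z y01 z01.
    rewrite (@le_trans _ _ 1)// ?lerDr ?mulr_ge0 ?powR_ge0 ?(ltW C0)//.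
    by rewrite ler_norml; lra.
  have [kyz|kyz] := eqVneq (k y) (k z).
    have -> : y - z = sg (k y) * (T y - T z).
      by rewrite {1}(TE y) {1}(TE z) -kyz; ring.
    have -> : phi y - phi z = rho (k y) * (phi (T y) - phi (T z)).
      by rewrite (phiE y) (phiE z) -kyz; ring.
    rewrite !normrM.
    have rho0 : 0 < rho (k y) by case/andP: (rhor (k y)).
    rewrite (gtr0_norm (sg0 _)) (gtr0_norm rho0) powRM ?(ltW rho0)//.
    have := IH _ _ (T01 _ y01) (T01 _ z01).
    set Q := `|_ - _| `^ s; set D := `|_ - _|; set w := 2^-1 ^+ n => DQ.
    have Q0 : 0 <= Q by exact: powR_ge0.
    have w0 : 0 <= w by rewrite exprn_ge0.
    rewrite exprS -/w; have := sg2 (k y); have := sgrho (k y); have := sg0 (k y).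
    move: (sg _) (rho _ `^ s) => sk rk h1 h2 h3.
    apply: le_trans (_ : sk * (C * Q + w) <= _); first by rewrite ler_pM2l.
    rewrite mulrDr lerD//; last by rewrite ler_wpM2r.
    by rewrite mulrCA ler_pM2l// ler_wpM2r.
  rewrite (@le_trans _ _ 1)//; first by rewrite ler_norml; lra.
  rewrite -[leLHS]addr0 lerD ?exprn_ge0//.
  rewrite -[leLHS](@mulVf _ (g `^ s)) ?gt_eqF ?powR_gt0// ler_pM2l//.
  apply: ge0_ler_powR; rewrite ?nnegrE ?(ltW g0)//.
  by rewrite phiE (phiE z); exact: sep.
have {}Hphi y z : 0 <= y < 1 -> 0 <= z < 1 ->
    `|y - z| <= C * `|phi y - phi z| `^ s.
  move=> y01 z01; apply: (@geometric_le _ 2^-1); first by lra.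
  by move=> n; exact: Hphi.
have main : ((2 * C)^-1%:E <= hausdorff_content s 1 K)%E.
  apply: le_ereal_inf_tmp => _ [U [KU Ud] <-].
  have U2 j : (0 <= (2 * C)%:E * hterm s (U j))%E.
    by rewrite mule_ge0 ?hterm_ge0// lee_fin mulr_ge0// ltW.
  pose J j y := 0 <= y < 1 /\ U j (phi y).
  pose D j := C * fine (diam (U j)) `^ s.
  (* The preimage of [U j] by [phi] need not be measurable; it is enclosed in an interval of radius
     [D j] around one of its points. The length 2 [D j] explains the constant 2 [C]. *)
  pose Y j := if pselect (exists y, J j y) is left ex then
    [set` `[xget 0 (J j) - D j, xget 0 (J j) + D j]] else set0.
  have Ym j : measurable (Y j).
    by rewrite /Y; case: pselect => // ?; exact: measurable_itv.
  have YU : [set` `[(0 : R), 1[] `<=` \bigcup_j Y j.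
    move=> y; rewrite /= in_itv/= => y01.
    have [j _ Uj] := KU _ (Kphi y); exists j => //.
    have Jy : J j y by [].
    rewrite /Y; case: pselect => [?|[]]; last by exists y.
    rewrite /= in_itv/=; case: xgetP => [z _ [z01 Uz]|/(_ y)//].
    rewrite -ler_distl; apply: le_trans (Hphi _ _ y01 z01) _.
    rewrite ler_pM2l//; apply: ge0_ler_powR; rewrite ?nnegrE//.
      by rewrite (le_trans (normr_ge0 _) (dist_le_fine_diam (Ud j) Uj Uj)).
    exact: dist_le_fine_diam (Ud j) Uj Uz.
  have h : (lebesgue_measure [set` `[0%R : R, 1%R[] <=
      \sum_(j <oo) lebesgue_measure (Y j))%E.
    exact: (@measure_sigma_subadditive _ _ _ lebesgue_measure _ _ Ym (measurable_itv _) YU).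
  rewrite lebesgue_measure_itv/= lte_fin ltr01 sube0 in h.
  suff : (1 <= (2 * C)%:E * \sum_(j <oo) hterm s (U j))%E.
    by move=> h1; rewrite -[leLHS]mule1 lee_pdivrMl// mulr_gt0.
  apply: le_trans h _.
  rewrite -nneseriesZl; last by move=> *; exact: hterm_ge0.
  apply: lee_nneseries => j _; first by move=> *; exact: measure_ge0.
  rewrite /Y; case: pselect => [[y [_ Uy]]|_]; last by rewrite measure0.
  have D0 : 0 <= D j by rewrite mulr_ge0 ?powR_ge0// ltW.
  rewrite lebesgue_measure_itv/=; case: ifP => // _.
  rewrite hterm_neq0; last by exists (phi y).
  by rewrite -EFinD -EFinM lee_fin -mulrA -/(D j); lra.
move=> H0; move: main; rewrite leNgt => /negP; apply.
apply: le_lt_trans (_ : 0 < _)%E; last by rewrite lte_fin invr_gt0 mulr_gt0.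
by rewrite -H0; apply: ereal_sup_ubound; exists 1 => /=.
Qed.

End Lower.

(** * Finite affine systems and their iterates *)

Section AffineSystem.
Variable R : realType.

(** The images of [0, 1] may touch but not overlap. Ratio 1 is allowed so that the identity alone is
    a system, namely the zeroth iterate. *)
Definition affine_system (K : set R) (I : finType) (A rho : I -> R) : Prop :=
  [/\ forall i, 0 < rho i <= 1,
      forall i, 0 <= A i /\ A i + rho i <= 1,
      forall i j, i != j -> A i + rho i <= A j \/ A j + rho j <= A i &
      forall i x, K x -> K (A i + rho i * x)].

Lemma affine_system_comp K (I J : finType) (A rho : I -> R) (A' rho' : J -> R) :
  affine_system K A rho -> affine_system K A' rho' ->
  affine_system K (fun ij : I * J => A ij.1 + rho ij.1 * A' ij.2)
    (fun ij => rho ij.1 * rho' ij.2).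
Proof.
move=> [rho1 A01 Adis KA] [rho1' A01' Adis' KA']; split.
- move=> [i j] /=; have /andP[? ?] := rho1 i; have /andP[? ?] := rho1' j.
  by rewrite mulr_gt0//= mulr_ile1// ltW.
- move=> [i j] /=; have [? ?] := A01 i; have [? ?] := A01' j.
  by have /andP[? ?] := rho1 i; split; nra.
- move=> [i j] [i' j'] /=; have [<-|ii' _] := eqVneq i i'.
    rewrite xpair_eqE eqxx /= => /Adis'.
    have /andP[? ?] := rho1 i.
    by case=> h; [left|right]; rewrite -addrA lerD2l -mulrDr ler_pM2l.
  have := A01' j; have := A01' j'; have := rho1 i; have := rho1 i'.
  move=> /andP[? ?] /andP[? ?] [? ?] [? ?].
  by case: (Adis _ _ ii') => ?; [left|right]; nra.
- by move=> [i j] x Kx /=; rewrite -addrA -mulrA -mulrDr; apply/KA/KA'.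
Qed.

Lemma affine_system_exp K (I : finType) (A rho : I -> R) (s : R) n :
  affine_system K A rho -> exists (J : finType) (A' rho' : J -> R),
    affine_system K A' rho' /\
    \sum_j rho' j `^ s = (\sum_i rho i `^ s) ^+ n.
Proof.
move=> sys; elim: n => [|n [J [A' [rho' [sys' sumE]]]]].
  exists unit, (fun=> 0), (fun=> 1); split.
    split=> [_|_|[] []//|_ x Kx].
    - by rewrite ltr01 lexx.
    - by rewrite add0r.
    - by rewrite add0r mul1r.
  by rewrite expr0 (bigD1 tt)//= big1 ?addr0 ?powR1// => -[].
exists (I * J)%type, (fun ij => A ij.1 + rho ij.1 * A' ij.2),
  (fun ij => rho ij.1 * rho' ij.2); split; first exact: affine_system_comp.
rewrite exprS -sumE mulr_suml.
under [RHS]eq_bigr do rewrite mulr_sumr.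
rewrite pair_big/=; apply: eq_bigr => -[i j] _ /=.
case: sys sys' => rho1 _ _ _ [rho1' _ _ _].
by rewrite powRM//; [case/andP: (rho1 i) => /ltW|case/andP: (rho1' j) => /ltW].
Qed.

(* Composing every map of a large iterate of the system with a map sending [0, 1] into the open interval ]0, 1[ makes the images of [0, 1] pairwise separated, at the cost of a bounded factor only. *)
Lemma hausdorff_measure_affine_system (I : finType) (A rho : I -> R)
    (K : set R) (s : R) :
  closed K -> K !=set0 -> K `<=` [set` `[0, 1]] -> 0 <= s ->
  affine_system K A rho -> 1 < \sum_i rho i `^ s ->
  hausdorff_measure s K <> 0%E.
Proof.
move=> clK K0 K01 s0 sys sum1; have [rho1 A01 Adis KA] := sys.
(* Otherwise there is at most one map, and the sum is at most 1. *)
have [i [j ij]] : exists i j, A i + rho i <= A j.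
  apply: contrapT => h; move: sum1; rewrite ltNge => /negP; apply.
  have I1 (i j : I) : i = j.
    apply/eqP/negPn/negP => /Adis[] ?; apply: h; first by exists i, j.
    by exists j, i.
  have [i0 _|I0] := pickP I; last by rewrite big_pred0.
  rewrite (bigD1 i0)//= big1 ?addr0; last by move=> i; rewrite (I1 i i0) eqxx.
  have p1 : (1 : R) `^ s = 1 by rewrite powR1.
  have /andP[/ltW r0 r1] := rho1 i0.
  by rewrite -[leRHS]p1 ge0_ler_powR// ?nnegrE.
(* The extra map is [f_i] after [f_j]. As [i] lies to the left of [j], [A j] is positive and
   [A i + rho i] is less than 1, so its image avoids 0 and 1. *)
pose c := A i + rho i * A j; pose e := rho i * rho j.
have [[Ai Ai1] [Aj Aj1]] := (A01 i, A01 j).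
have [/andP[ri ri1] /andP[rj rj1]] := (rho1 i, rho1 j).
have c0 : 0 < c by rewrite /c; nra.
have e0 : 0 < e by rewrite mulr_gt0.
have ce1 : c + e < 1 by rewrite /c /e; nra.
have Kce x : K x -> K (c + e * x).
  by move=> Kx; rewrite /c /e -addrA -mulrA -mulrDr; apply/KA/KA.
have [n n2] : exists n, 2 <= (\sum_i rho i `^ s) ^+ n * e `^ s.
  set S := \sum_i _ in sum1 *.
  have S0 : 0 < S by rewrite (lt_trans _ sum1).
  have es0 : 0 < e `^ s / 2 by rewrite divr_gt0// powR_gt0.
  have /cvgrPdist_le/(_ _ es0)[n _ /(_ n (leqnn _))] :
      (GRing.exp S^-1) n @[n --> \oo] --> (0 : R).
    by apply: cvg_expr; rewrite ger0_norm ?invr_ge0 ?(ltW S0)// invf_lt1.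
  rewrite /= sub0r normrN ger0_norm ?exprn_ge0 ?invr_ge0 ?(ltW S0)// exprVn => h.
  exists n; rewrite -ler_pdivrMl ?exprn_gt0//.
  by move: h; rewrite ler_pdivlMr.
have [J [A' [rho' [[rho1' A01' Adis' KA'] sumE]]]] := affine_system_exp s n sys.
(* A positive lower bound for all the ratios. The left margin [rho' l * c] of the right-hand image
   then yields the uniform gap [m * c]. *)
pose m := \prod_k rho' k.
have m0 : 0 < m by apply: prodr_gt0 => k _; case/andP: (rho1' k).
have mle k : m <= rho' k.
  rewrite /m (bigD1 k)//= ler_piMr//; first by case/andP: (rho1' k) => /ltW.
  by apply: prodr_ile1 => l _; have /andP[/ltW-> ->] := rho1' l.
apply: (@hausdorff_measure_separated _ J (fun k => A' k + rho' k * c)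
  (fun k => rho' k * e) K s e (m * c)) => //.
- move=> k; have /andP[r0 r1] := rho1' k.
  by rewrite mulr_gt0//= ler_piMl// ltW.
- lra.
- by move=> k; have /andP[r0 r1] := rho1' k; have [? ?] := A01' k; split; nra.
- by move=> k x Kx; rewrite -addrA -mulrA -mulrDr; apply/KA'/Kce.
- by rewrite mulr_gt0.
- have sep k l x y : A' k + rho' k <= A' l -> 0 <= x <= 1 -> 0 <= y <= 1 ->
      m * c <= A' l + rho' l * c + rho' l * e * y -
               (A' k + rho' k * c + rho' k * e * x).
    move=> kl /andP[x0 x1] /andP[y0 y1].
    have /andP[k0 k1] := rho1' k; have /andP[l0 l1] := rho1' l.
    have h1 : m * c <= rho' l * c by rewrite ler_pM2r.
    have h2 : 0 <= rho' l * e * y by rewrite !mulr_ge0// ltW.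
    have h3 : rho' k * e * x <= rho' k * e.
      by rewrite ler_piMr// mulr_ge0// ltW.
    have h4 : rho' k * (c + e) <= rho' k by rewrite ler_piMr// ltW.
    by rewrite mulrDr in h4; lra.
  move=> k l x y /Adis'[kl|lk] x01 y01; rewrite ler_normr; apply/orP.
    by right; rewrite opprB; exact: sep.
  by left; exact: sep.
- apply: le_trans n2 _; rewrite -sumE mulr_suml; apply: ler_sum => k _.
  by have /andP[/ltW r0 _] := rho1' k; rewrite powRM// ltW.
Qed.

End AffineSystem.

(** * Dimension estimates for the attractor *)

Section Attractor.
Variables (R : realType) (q a : nat -> R).
Hypothesis gls : gls_system q a.

(** Every [q i] with [i > 0] is at most [1 - q 0], and [q 0 < 1] because [q 1 > 0]. *)
Lemma gls_system_ratio : exists2 r, r < 1 & forall i, 0 < q i <= r.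
Proof.
have [q0 [q1 _]] := gls.
have qqi i : (0 < i)%N -> q 0%N + q i <= 1.
  move=> i0; rewrite -lee_fin -q1.
  apply: le_trans (_ : \sum_(0 <= k < i.+1) (q k)%:E <= _)%E; last first.
    by apply: nneseries_lim_ge => k _ _; rewrite lee_fin ltW.
  rewrite sumEFin lee_fin big_nat_recr//= lerD2r big_ltn// lerDl.
  by apply: sumr_ge0 => k _; exact: ltW.
exists (Num.max (q 0%N) (1 - q 0%N)).
  rewrite gt_max; have := qqi 1%N isT; have := q0 0%N; have := q0 1%N => *.
  by apply/andP; split; lra.
case=> [|i]; first by rewrite q0 le_max lexx.
by rewrite q0 le_max lerBrDl qqi ?orbT.
Qed.

Let a01 i : 0 <= a i /\ a i + q i <= 1.
Proof. by case: gls => [_ [_ []]]. Qed.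

Let q0 i : 0 < q i. Proof. by case: gls. Qed.

Variable V : pred nat.

(** The closure is taken because the points with digits in an infinite [V] need not form a closed
    set. *)
Definition gls_attractor : set R :=
  closure [set gls_point q a s | s in [set s | forall k, V (s k)]].

Let r := xget 0 [set r | r < 1 /\ forall i, 0 < q i <= r].
Let r1 : r < 1.
Proof.
by rewrite /r; case: xgetP => [? -> []//|h];
  have [x x1 /(conj x1)/h] := gls_system_ratio.
Qed.
Let qr i : 0 < q i <= r.
Proof.
by rewrite /r; case: xgetP => [? -> []//|h];
  have [x x1 /(conj x1)/h] := gls_system_ratio.
Qed.

Lemma gls_attractor_closed : closed gls_attractor.
Proof. exact: closed_closure. Qed.

Lemma gls_attractor01 : gls_attractor `<=` [set` `[0, 1]].
Proof.
have /closure_id -> : closed [set` `[0 : R, 1]] by exact: interval_closed.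
apply: closure_subset => _ [s _ <-] /=.
by rewrite in_itv/=; exact: gls_point01 qr a01 s.
Qed.

Lemma gls_attractor_neq0 i : V i -> gls_attractor !=set0.
Proof.
move=> Vi; exists (gls_point q a (fun=> i)).
by apply: subset_closure; exists (fun=> i).
Qed.

Lemma gls_attractor_stable i x :
  V i -> gls_attractor x -> gls_attractor (a i + q i * x).
Proof.
move=> Vi Kx B Bx.
have cf : {for x, continuous (fun z => a i + q i * z)}.
  by apply: cvgD; [exact: cvg_cst|apply: cvgM; [exact: cvg_cst|exact: cvg_id]].
have [_ [[s Vs <-] Bs]] := Kx _ (cf _ Bx).
exists (a i + q i * gls_point q a s); split => //.
exists (fun n => if n is k.+1 then s k else i); first by case.
by rewrite (gls_pointS qr r1 a01).
Qed.

Lemma gls_attractor_sub :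
  gls_attractor `<=`
    (gls_infty q a `|` \bigcup_i [set a i; a i + q i]) `|`
    \bigcup_(i in V) (fun x => a i + q i * x) @` gls_attractor.
Proof.
move=> x Kx; have x01 := gls_attractor01 Kx.
have [[i _ Dx]|xD] := pselect ((\bigcup_(i in setT) [set` `[a i, a i + q i]]) x);
  last by left; left.
have [->|xa] := eqVneq x (a i); first by left; right; exists i => //; left.
have [->|xb] := eqVneq x (a i + q i); first by left; right; exists i => //; right.
move: Dx; rewrite /= in_itv/= !le_eqVlt eq_sym (negbTE xa) (negbTE xb) /= => xi.
(* A different first digit would put the point in another cylinder of rank 1, which does not meet
   the interior of this one. *)
have digit s : gls_point q a s \in `]a i, a i + q i[ -> s 0%N = i.
  move=> si; apply: contrapT => s0i; case: gls => _ [_ [_ /(_ _ _ s0i)]].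
  move: si; rewrite (gls_pointS qr r1 a01) in_itv/= /gls_f => /andP[l1 l2].
  have /andP[p0 p1] := gls_point01 qr a01 (fun n => s n.+1).
  by have := q0 (s 0%N) => q0' []; nra.
have nx : nbhs x [set` `]a i, a i + q i[].
  by apply: open_nbhs_nbhs; split; [exact: interval_open|rewrite /= in_itv].
have [_ [[s Vs <-] /digit s0]] := Kx _ nx.
right; exists i; first by rewrite -s0; exact: Vs.
have xE : a i + q i * ((x - a i) / q i) = x.
  by rewrite mulrC divfK ?gt_eqF// addrC subrK.
exists ((x - a i) / q i) => // B By.
have cg : {for x, continuous (fun z => (z - a i) / q i)}.
  by apply: cvgM; [apply: cvgB; [exact: cvg_id|exact: cvg_cst]|exact: cvg_cst].
(* A neighbourhood of the rescaled point is pulled back to [x] and cut down to the open cylinder: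
   the coded point found there starts with [i], and its shift lies in [B]. *)
have [_ [[t Vt <-] [/digit t0 Bt]]] := Kx _ (filterI nx (cg _ By)).
exists (gls_point q a (fun n => t n.+1)); split.
  by exists (fun n => t n.+1).
move: Bt; rewrite /= (gls_pointS qr r1 a01) t0 /gls_f.
by rewrite addrAC subrr add0r mulrC mulKf ?gt_eqF.
Qed.

Lemma countable_endpoints : countable (\bigcup_i [set a i; a i + q i]).
Proof.
by apply: bigcup_countable => // i _; exact/finite_set_countable/finite_set2.
Qed.

Lemma gls_attractor_dim_le s : countable (gls_infty q a) ->
  0 < s -> (\sum_(i <oo | V i) (q i `^ s)%:E < 1)%E ->
  hausdorff_measure s gls_attractor = 0%E.
Proof.
move=> cinf s0; apply: hausdorff_measure_self_affine gls_attractor_sub => //.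
- by move=> i; have /andP[/ltW-> /le_trans->] := qr i; rewrite // ltW.
- exact: gls_attractor01.
- rewrite -bigcup2E; apply: bigcup_countable => // -[|[|n]] _ //=.
  exact: countable_endpoints.
Qed.

Lemma gls_attractor_dim_ge s (N : nat) : 0 <= s ->
  1 < \sum_(i < N | V i) q i `^ s -> hausdorff_measure s gls_attractor <> 0%E.
Proof.
move=> s0 sum1.
have [i Vi|V0] := pickP (fun i : 'I_N => V i); last first.
  by move: sum1; rewrite big_pred0// ltr10.
pose I := {i : 'I_N | V i}.
apply: (@hausdorff_measure_affine_system _ I (fun i => a (val i))
  (fun i => q (val i))) => //.
- exact: gls_attractor_closed.
- exact: gls_attractor_neq0 Vi.
- exact: gls_attractor01.
- split=> [j|j|j k jk|j x].
  + by have /andP[-> /le_trans->] := qr (val (val j)); rewrite // ltW.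
  + exact: a01.
  + have [_ [_ [_]]] := gls; apply => /val_inj/val_inj kj.
    by rewrite kj eqxx in jk.
  + by apply: gls_attractor_stable; exact: (valP j).
- apply: lt_le_trans sum1 _; rewrite [leRHS](_ : _ = \sum_(j < N | V j) q j `^ s)//.
  rewrite [RHS](reindex_omap (fun j : I => val j) (insub : 'I_N -> option I))/=.
    by apply: eq_bigl => j; rewrite valK eqxx (valP j).
  by move=> j Vj; rewrite insubT.
Qed.

End Attractor.

(** * The spectrum *)

Section Spectrum.
Variables (R : realType) (q a p : nat -> R).
Context {d : measure_display} {T : measurableType d}.
Variables (P : probability T R) (xi : nat -> T -> nat).

Lemma measurable_discrete_comp (f : nat -> R) (eta : T -> nat) :
  (forall i, measurable [set t | eta t = i]) ->
  measurable_fun [set: T] (f \o eta).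
Proof.
move=> meta _ B mB; rewrite setTI.
rewrite (_ : _ @^-1` _ = \bigcup_(i in f @^-1` B) [set t | eta t = i]).
  by apply: bigcup_measurable.
by apply/seteqP; split=> t /=; [exists (eta t)|case=> i /= Bi ->].
Qed.

Lemma measurable_gls_comp (eta : nat -> T -> nat) n x :
  (forall k i, measurable [set t | eta k t = i]) ->
  measurable_fun [set: T] (fun t => gls_comp q a (fun k => eta k t) n x).
Proof.
elim: n eta => [|n IH] eta meta; first exact: measurable_cst.
apply: measurable_realfun.measurable_funD.
  exact: (measurable_discrete_comp a (meta 0%N)).
apply: measurable_realfun.measurable_funM.
  exact: (measurable_discrete_comp q (meta 0%N)).
by apply: (IH (fun k => eta k.+1)).
Qed.

Lemma gls_comp_eq (s s' : nat -> nat) n x :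
  (forall k, (k < n)%N -> s k = s' k) ->
  gls_comp q a s n x = gls_comp q a s' n x.
Proof.
elim: n s s' => [|n IH] s s' ss' //=.
by rewrite ss'// (IH _ (fun k => s' k.+1))// => k kn; rewrite ss'.
Qed.

Hypothesis gls : gls_system q a.
Hypothesis p0 : forall i, 0 <= p i.
Hypothesis indep : indep_nat_seq P xi.
Hypothesis distr : ident_distr P xi p.

Let X t := gls_point q a (fun k => xi k t).

Let mxi k i : measurable [set t | xi k t = i].
Proof. by case: indep. Qed.

Lemma measurable_gls_point : measurable_fun [set: T] X.
Proof.
have [r r1 qr] := gls_system_ratio gls.
apply: measurable_realfun.measurable_fun_cvg => [n|t _].
  exact: (@measurable_gls_comp xi n 0).
apply: (gls_comp_cvg qr r1); first by case: gls => [_ [_ []]].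
by rewrite lexx ler01.
Qed.

(** Almost surely no digit of probability 0 occurs, by countable union over ranks and digits.
    Conversely a closed set of full measure contains every point with digits in [V]: missing one, it
    would miss a small cylinder around it, whose digit event has positive probability by
    independence. *)
Lemma spectrum_gls_point : spectrum P X = gls_attractor q a (fun i => 0 < p i).
Proof.
have [r r1 qr] := gls_system_ratio gls.
have a01 i : 0 <= a i /\ a i + q i <= 1 by case: gls => [_ [_ []]].
have mX S : closed S -> measurable (X @^-1` S).
  move=> clS; rewrite -[_ @^-1` _]setTI; apply: measurable_gls_point => //.
  exact: measurable_realfun.closed_measurable.
apply/seteqP; split.
  apply: bigcap_inf; split; first exact: closed_closure.
  have mXK := mX _ (@gls_attractor_closed R q a (fun i => 0 < p i)).
  suff PC : P (~` (X @^-1` gls_attractor q a (fun i => 0 < p i))) = 0%E.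
    by rewrite -[X @^-1` _]setCK probability_setC ?PC ?sube0//; exact: measurableC.
  apply: measure_negligible; first exact: measurableC.
  apply: (@negligibleS _ _ _ _ (\bigcup_k \bigcup_i
      (if 0 < p i then set0 else [set t | xi k t = i]))).
    move=> t; apply: contra_notP => ht.
    apply: subset_closure; exists (fun k => xi k t) => // k /=.
    apply: contrapT => /negP/negbTE pk; apply: ht.
    by exists k => //; exists (xi k t) => //; rewrite pk.
  apply: negligible_bigcup => k; apply: negligible_bigcup => i.
  case: ifPn => [_|pi]; first exact: negligible_set0.
  apply/negligibleP; first exact: mxi.
  apply: etrans (distr k i) _; congr _%:E.
  by apply/le_anti; rewrite p0 leNgt pi.
move=> x Kx S /= [clS PS].
suff ES : [set gls_point q a s | s in [set s | forall k, 0 < p (s k)]] `<=` S.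
  by have := closure_subset ES Kx; rewrite -(proj1 (closure_id S) clS).
move=> _ [v pv <-]; apply: contrapT => nS.
have /(_ _ nS) : open (~` S) by exact: closed_openC.
rewrite nbhs_ballP => -[e /= e0 eS].
have /cvgrPdist_lt/(_ _ e0)[n _ /(_ n (leqnn _))] :
    (GRing.exp r) n @[n --> \oo] --> (0 : R).
  apply: cvg_expr; rewrite ger0_norm//.
  by have /andP[h1 h2] := qr 0%N; rewrite ltW// (lt_le_trans h1 h2).
rewrite /= sub0r normrN => rne.
pose A := [set t | forall k, k \in iota 0 n -> xi k t = v k].
have mA : measurable A.
  rewrite (_ : A = \bigcap_(k in [set k | k \in iota 0 n]) [set t | xi k t = v k]).
    by apply: bigcap_measurableType.
  by apply/seteqP; split=> t /=.
have PA : P A = (\prod_(k <- iota 0 n) p (v k))%:E.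
  have [_ ->] := indep; last exact: iota_uniq.
  rewrite -prodEFin; apply: eq_bigr => k _; exact: distr.
have : (P A <= P (~` (X @^-1` S)))%E.
  apply: le_measure; rewrite ?inE//; first by apply/measurableC/mX.
  move=> t At; apply: eS; apply: le_lt_trans rne.
  apply: (le_trans _ (ler_norm _)).
  apply: (gls_cylinder_dist qr (s := v)); first exact: gls_cylinder_point qr a01 v n.
  have [y y01 yX] := gls_cylinder_point qr a01 (fun k => xi k t) n.
  exists y => //; apply: etrans yX; apply/esym/gls_comp_eq => k kn.
  by apply: At; rewrite mem_iota.
rewrite probability_setC; last exact: mX.
rewrite PS subee// PA lee_fin leNgt => /negP; apply.
by apply: prodr_gt0 => k _; exact: pv.
Qed.

End Spectrum.

(** * The sums of powers of the ratios *)

Section PowerSeries.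
Variables (R : realType) (q : nat -> R) (r : R) (V : pred nat).
Hypothesis qr : forall i, 0 < q i <= r.
Hypothesis r1 : r < 1.

Let F x := (\sum_(i <oo | V i) (q i `^ x)%:E)%E.

(** The factor does not depend on [i], which keeps the decrease strict for infinite sums. *)
Lemma powR_ratio s t i : s <= t -> q i `^ t <= r `^ (t - s) * q i `^ s.
Proof.
move=> st; have /andP[q0 qir] := qr i.
rewrite -{1}(subrK s t) (@powRD _ (q i)); last by rewrite (gt_eqF q0) implybT.
rewrite ler_wpM2r ?powR_ge0// ge0_ler_powR ?subr_ge0// nnegrE ltW//.
exact: lt_le_trans q0 qir.
Qed.

Lemma powR_ratio_lt1 s t : s < t -> r `^ (t - s) < 1.
Proof.
move=> st; have p1 : (1 : R) `^ (t - s) = 1 by rewrite powR1.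
have /andP[q0 qir] := qr 0%N.
by rewrite -[ltRHS]p1 gt0_ltr_powR ?subr_gt0// nnegrE ltW// (lt_le_trans q0 qir).
Qed.

Lemma power_series_lt1 s t : s < t -> (F s <= 1)%E -> (F t < 1)%E.
Proof.
move=> st Fs; apply: le_lt_trans (_ : (r `^ (t - s))%:E * F s < _)%E.
  rewrite -nneseriesZl; last by move=> *; rewrite lee_fin powR_ge0.
  apply: lee_nneseries => i *; rewrite ?lee_fin ?powR_ge0//.
  exact/powR_ratio/ltW.
apply: le_lt_trans (_ : (r `^ (t - s))%:E * 1 < _)%E.
  by rewrite lee_wpmul2l// lee_fin powR_ge0.
by rewrite mule1 lte_fin powR_ratio_lt1.
Qed.

(** If all partial sums at [s] were at most 1, so would be [F s], whence [F t < 1]. A finite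
    subsystem is thus extracted even when [F s] is infinite. *)
Lemma power_series_gt1 s t : s < t -> (1 <= F t)%E ->
  exists N, 1 < \sum_(i < N | V i) q i `^ s.
Proof.
move=> st Ft; apply: contrapT => h; move: Ft; rewrite leNgt => /negP; apply.
apply: power_series_lt1 st _; apply: lime_le.
  by apply: is_cvg_nneseries => *; rewrite lee_fin powR_ge0.
apply: nearW => n; rewrite sumEFin lee_fin big_mkord leNgt.
by apply/negP => h'; apply: h; exists n.
Qed.

End PowerSeries.

Lemma hausdorff_dim_eq (R : realType) (K : set R) (al : R) : 0 <= al ->
  (forall s, al < s -> hausdorff_measure s K = 0%E) ->
  (forall s, 0 <= s < al -> hausdorff_measure s K <> 0%E) ->
  hausdorff_dim K = al%:E.
Proof.
move=> al0 hi lo; apply/le_anti/andP; split.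
  apply/lee_addgt0Pr => e e0; apply: ereal_inf_lbound.
  by exists (al + e) => //; split; [rewrite addr_ge0// ltW|apply: hi; rewrite ltrDl].
apply: le_ereal_inf_tmp => _ [s [s0 Ks] <-]; rewrite lee_fin leNgt.
by apply/negP => sal; apply: (lo s) Ks; rewrite s0.
Qed.

(** * Roots of the truncated equations and their limit *)

Section RootLimit.
Variables (R : realType) (q : nat -> R) (r : R) (V : pred nat) (e : nat -> nat).
Hypothesis qr : forall i, 0 < q i <= r.
Hypothesis r1 : r < 1.
Hypothesis q1 : (\sum_(i <oo) (q i)%:E = 1)%E.
Hypothesis e_inj : injective e.
Hypothesis e_range : range e = [set i | V i].
Variable alpha : nat -> R.
Hypothesis alphaP : forall k, \sum_(j < k.+1) (q (e j)) `^ (alpha k) = 1.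

Let F x := (\sum_(i <oo | V i) (q i `^ x)%:E)%E.

Lemma power_series_enum x : F x = (\sum_(j <oo) (q (e j) `^ x)%:E)%E.
Proof.
rewrite /F nneseries_esum; last by move=> *; rewrite lee_fin powR_ge0.
rewrite nneseries_esumT; last by move=> *; rewrite lee_fin powR_ge0.
apply: (@reindex_esum _ _ _ setT _ e); rewrite -e_range.
by split => //; move=> i j _ _ /e_inj.
Qed.

Lemma power_series_root k : (1 <= F (alpha k))%E.
Proof.
rewrite power_series_enum -(alphaP k).
rewrite -sumEFin -(big_mkord xpredT (fun j => (q (e j) `^ alpha k)%:E)).
by apply: nneseries_lim_ge => *; rewrite lee_fin powR_ge0.
Qed.

Lemma root_ge0 k : 0 <= alpha k.
Proof.
rewrite leNgt; apply/negP => ak.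
have : q (e 0%N) `^ alpha k <= 1.
  rewrite -[leRHS](alphaP k) big_ord_recl lerDl.
  by apply: sumr_ge0 => *; exact: powR_ge0.
have := powR_ratio qr (e 0%N) (ltW ak); have := powR_ratio_lt1 qr r1 ak.
rewrite powRr0; set x := r `^ _; set y := _ `^ _ => x1 xy y1.
have : 0 <= x by exact: powR_ge0.
by move: xy; nra.
Qed.

(** At exponent 1 the series is at most the sum of all [q i], so beyond 1 it is below 1, whereas at
    a root it is at least 1. *)
Lemma root_le1 k : alpha k <= 1.
Proof.
rewrite leNgt; apply/negP => ak.
have : (F (alpha k) < 1)%E.
  apply: (power_series_lt1 qr r1 ak); rewrite -q1 eseries_mkcond.
  have q0 i : 0 <= q i by case/andP: (qr i) => /ltW.
  apply: lee_nneseries => i *; case: ifP => // _; rewrite lee_fin ?powR_ge0//.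
  by rewrite powRr1.
by rewrite ltNge power_series_root.
Qed.

(** Were the next root smaller, the first [k.+1] terms alone would already exceed 1 there. *)
Lemma root_nondecreasing : nondecreasing_seq alpha.
Proof.
apply/nondecreasing_seqP => k; rewrite leNgt; apply/negP => ak.
have : \sum_(j < k.+1) q (e j) `^ alpha k.+1 <= 1.
  by rewrite -[leRHS](alphaP k.+1) [leRHS]big_ord_recr lerDl powR_ge0.
rewrite leNgt => /negP; apply; rewrite -[ltLHS](alphaP k).
apply: le_lt_trans (_ : r `^ (alpha k - alpha k.+1) *
    \sum_(j < k.+1) q (e j) `^ alpha k.+1 < _).
  by rewrite mulr_sumr ler_sum// => j _; exact/powR_ratio/ltW.
rewrite gtr_pMl ?(powR_ratio_lt1 qr r1 ak)// big_ord_recl ltr_wpDr//.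
  by apply: sumr_ge0 => *; exact: powR_ge0.
by rewrite powR_gt0//; case/andP: (qr (e 0%N)).
Qed.

Lemma root_cvg : exists l, [/\ alpha @ \oo --> l, 0 <= l,
  forall s, l < s -> (F s < 1)%E &
  forall s, s < l -> exists N, 1 < \sum_(i < N | V i) q i `^ s].
Proof.
have ub : has_ubound (range alpha).
  by exists 1 => _ [k _ <-]; exact: root_le1.
have al k : alpha k <= sup (range alpha) by apply: ub_le_sup => //; exists k.
exists (sup (range alpha)); split.
- exact: nondecreasing_cvgn root_nondecreasing ub.
- exact: le_trans (root_ge0 0) (al 0%N).
(* The midpoint exceeds every root, so all partial sums there are at most 1; strictness is gained
   between it and [s]. The sum of [n] terms is compared at [alpha n.-1], since [alpha k] belongs to
   [k.+1] terms. *)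
- move=> s ls; apply: (@power_series_lt1 _ _ _ _ qr r1 ((sup (range alpha) + s) / 2)).
    by lra.
  rewrite -/(F _) power_series_enum; apply: lime_le.
    by apply: is_cvg_nneseries => *; rewrite lee_fin powR_ge0.
  near=> n; rewrite sumEFin lee_fin big_mkord.
  have n0 : (0 < n)%N by near: n; exists 1%N.
  rewrite -[leRHS](alphaP n.-1) prednK//; apply: ler_sum => j _.
  have st : alpha n.-1 < (sup (range alpha) + s) / 2.
    by rewrite (le_lt_trans (al n.-1))//; lra.
  apply: le_trans (powR_ratio qr _ (ltW st)) _.
  by rewrite ler_piMl ?powR_ge0// ltW// (powR_ratio_lt1 qr r1 st).
- move=> s sl; have [_ [k _ <-] sk] : exists2 x, range alpha x & s < x.
    apply: contrapT => h; move: sl; rewrite ltNge => /negP; apply.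
    apply: ge_sup => [|x ax]; first by exists (alpha 0%N), 0%N.
    by rewrite leNgt; apply/negP => sx; apply: h; exists x.
  have := power_series_root k; rewrite /F => Fk.
  by have := power_series_gt1 qr r1 sk Fk.
Unshelve. all: by end_near. Qed.

End RootLimit.

Theorem theorem4 (R : realType) (q a p : nat -> R)
  (d : measure_display) (T : measurableType d) (P : probability T R)
  (xi : nat -> T -> nat) :
  gls_system q a ->
  (forall i, 0 <= p i) -> (\sum_(i <oo) (p i)%:E = 1)%E ->
  indep_nat_seq P xi -> ident_distr P xi p ->
  countable (gls_infty q a) ->
  let X := fun t => gls_point q a (fun k => xi k t) in
  let F := fun x : R => (\sum_(i <oo | (0 < p i)%R) ((q i) `^ x)%:E)%E in
  (forall alpha0 : R, 0 <= alpha0 <= 1 -> F alpha0 = 1%E ->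
     (forall x : R, 0 <= x <= 1 -> F x = 1%E -> x = alpha0) ->
     hausdorff_dim (spectrum P X) = alpha0%:E)
  /\
  ((forall x : R, 0 <= x <= 1 -> F x <> 1%E) ->
   forall e : nat -> nat, injective e -> range e = [set i | 0 < p i] ->
   forall alpha : nat -> R,
     (forall k, \sum_(j < k.+1) (q (e j)) `^ (alpha k) = 1) ->
     exists l : R, alpha @ \oo --> l /\ hausdorff_dim (spectrum P X) = l%:E).
Proof.
move=> gls p0 _ indep distr cinf X F.
have [r r1 qr] := gls_system_ratio gls.
have KE : spectrum P X = gls_attractor q a (fun i => 0 < p i).
  exact: spectrum_gls_point.
(* Both claims reduce to showing that [l] is the critical exponent of the series: below 1 to its
   right, a finite partial sum above 1 to its left. *)
have dimE l : 0 <= l -> (forall s, l < s -> (F s < 1)%E) ->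
    (forall s, s < l -> exists N : nat, 1 < \sum_(i < N | 0 < p i) q i `^ s) ->
    hausdorff_dim (spectrum P X) = l%:E.
  move=> l0 hi lo; rewrite KE; apply: hausdorff_dim_eq => // s.
    move=> ls; apply: gls_attractor_dim_le => //; last exact: hi.
    exact: le_lt_trans ls.
  by move=> /andP[s0 /lo[N]]; exact: gls_attractor_dim_ge.
split=> [al /andP[al0 _] Fal _|_ e e_inj e_range alpha alphaP].
  apply: dimE => // s sal; first by apply: (power_series_lt1 qr r1 sal); rewrite -/(F al) Fal.
  by have /(power_series_gt1 qr r1 sal) : (1 <= F al)%E by rewrite Fal.
have q1 : (\sum_(i <oo) (q i)%:E = 1)%E by case: gls => _ [].
have [l [al_l l0 hi lo]] := root_cvg qr r1 q1 e_inj e_range alphaP.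
by exists l; split => //; exact: dimE.
Qed.
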